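(* The functor $U_{HLie} \colon \mathbf{HomLie} \to \mathbf{HomAs}$, $U_{HLie}(L) = F_{HNAs}(L)/I^\infty$ with the operations induced by $\mu_F$ and $\alpha_F$, is left adjoint to the commutator functor $HLie \colon \mathbf{HomAs} \to \mathbf{HomLie}$.
   Context: $\mathbb{K}$ is a field of characteristic $0$; modules, $\otimes$, $\operatorname{End}$ are over $\mathbb{K}$. **Hom-algebras.** A Hom-module is a pair $(V,\alpha)$ with $V$ a module and $\alpha \in \operatorname{End}(V)$ linear; morphisms are linear maps commuting with the $\alpha$'s. A Hom-nonassociative algebra is a triple $(A,\mu,\alpha)$ with $A$ a module, $\mu\colon A^{\otimes 2}\to A$ bilinear (written $xy=\mu(x,y)$) and $\alpha\in\operatorname{End}(A)$ linear (no compatibility between $\mu$ and $\alpha$ is assumed). Morphisms are linear maps $f$ with $\alpha' \circ f=f\circ\alpha$ and $f\circ\mu=\mu'\circ f^{\otimes 2}$. The category is $\mathbf{HomNonAs}$. A Hom-associative algebra is a Hom-nonassociative algebra with $\alpha(x)(yz)=(xy)\alpha(z)$ for all $x,y,z$. A Hom-Lie algebra is a Hom-nonassociative algebra $(L,[-,-],\alpha)$ with $[x,y]=-[y,x]$ and $0=[\alpha(x),[y,z]]+[\alpha(z),[x,y]]+[\alpha(y),[z,x]]$ for all $x,y,z$. $\mathbf{HomAs}$ and $\mathbf{HomLie}$ are the corresponding full subcategories of $\mathbf{HomNonAs}$. The functor $HLie\colon\mathbf{HomAs}\to\mathbf{HomLie}$ sends $(A,\mu,\alpha)$ to $(A,[-,-],\alpha)$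 with $[x,y]=xy-yx$, and is the identity on underlying linear maps of morphisms. **Weighted trees.** For $n\ge 1$, $T_n$ is the set of planar binary trees with $n$ leaves and one root (so each has $n-1$ internal vertices, and for $n\ge2$ the lowest one is connected to the root). A weighted $n$-tree is a pair $\tau=(\psi,w)$ with $\psi\in T_n$ and $w$ a function from the internal vertices of $\psi$ to $\mathbb{Z}_{\ge 0}$; the set of these is $T^{wt}_n$ ($T^{wt}_1=T_1$ has one element). The grafting $\tau\vee\tau'\in T^{wt}_{p+q}$ of $\tau\in T^{wt}_p$, $\tau'\in T^{wt}_q$ joins the roots of $\tau$ (left) and $\tau'$ (right) to form a new lowest internal vertex connected to a new root; the new vertex has weight $0$ and all other weights are kept. For $m\ge 0$, $\tau[m]$ is $\tau$ with $m$ added to the weight of the lowest internal vertex. **Free Hom-nonassociative algebra.** For a Hom-module $(V,\alpha_V)$, $F_{HNAs}(V)=\bigoplus_{n\ge1}\bigoplus_{\tau\in T^{wt}_n}V^{\otimes n}_\tau$, where $V^{\otimes n}_\tau$ is a copy of $V^{\otimes n}$, with generators $(x_1\otimes\cdots\otimes x_n)_\tau$. The product is $\mu_F\big((x_1\otimes\cdots\otimes x_n)_\tau,(x_{n+1}\otimes\cdots\otimes x_{n+m})_\sigma\big)=(x_1\otimes\cdots\otimes x_{n+m})_{\tau\vee\sigma}$. The linear map $\alpha_F$ is $\alpha_V$ on $V$ (the $n=1$ summand), and $\alpha_F\big((x_1\otimes\cdots\otimes x_n)_\tau\big)=(x_1\otimes\cdots\otimes x_n)_{\tau[1]}$ for $n\ge2$.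 $\iota\colon V\hookrightarrow F_{HNAs}(V)$ is the inclusion of the $n=1$ summand. **Ideals.** In a Hom-nonassociative algebra $A$, the two-sided ideal $\langle S\rangle$ generated by a nonempty subset $S$ is the submodule spanned by all parenthesized monomials $x_1\cdots x_n$ ($n\ge1$, any parenthesization, $x_i\in A$) with at least one $x_j\in S$; that is, the smallest submodule containing $S$ that is closed under left and right multiplication by all elements of $A$. It need not be closed under $\alpha$. **The functor $U_{HLie}$.** For a Hom-Lie algebra $(L,[-,-],\alpha)$, define two-sided ideals of $F_{HNAs}(L)$ by $$I^1=\langle\, \operatorname{im}(\mu_F\circ(\mu_F\otimes\alpha_F-\alpha_F\otimes\mu_F));\ [x,y]-(xy-yx)\text{ for }x,y\in L\,\rangle,$$ where $L$ is identified with $\iota(L)$ and $xy=\mu_F(\iota(x),\iota(y))$, and $$I^{n+1}=\langle I^n\cup\alpha_F(I^n)\rangle,\qquad I^\infty=\bigcup_{n\ge1}I^n.$$ $I^\infty$ is a two-sided ideal closed under $\alpha_F$, and $U_{HLie}(L)=F_{HNAs}(L)/I^\infty$ with the induced operations is a Hom-associative algebra. On morphisms, $U_{HLie}(f)$ is induced by $(x_1\otimes\cdots\otimes x_n)_\tau\mapsto(f(x_1)\otimes\cdots\otimes f(x_n))_\tau$. *)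

(* Defs.v *)
From HB Require Import structures.
From mathcomp Require Import all_boot all_order all_algebra.
From mathcomp Require Import boolp classical_sets functions cardinality fsbigop.

Set Implicit Arguments.
Unset Strict Implicit.
Unset Printing Implicit Defensive.

Import GRing.Theory.
Local Open Scope classical_set_scope.
Local Open Scope ring_scope.

Record category := Category {
  ob :> Type;
  mor : ob -> ob -> Type;
  idm : forall a, mor a a;
  cmp : forall a b c, mor b c -> mor a b -> mor a c;
  cmp1m : forall a b (f : mor a b), cmp (idm b) f = f;
  cmpm1 : forall a b (f : mor a b), cmp f (idm a) = f;
  cmpA : forall a b c d (h : mor c d) (g : mor b c) (f : mor a b),
    cmp h (cmp g f) = cmp (cmp h g) f }.

Arguments mor {C} a b : rename.
Arguments idm {C} a : rename.
Arguments cmp {C} {a b c} g f : rename.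

Definition full_subcategory (C : category) (P : C -> Prop) : category :=
  @Category {a : C | P a} (fun a b => mor (sval a) (sval b))
    (fun a => idm (sval a)) (fun a b c g f => cmp g f)
    (fun a b f => cmp1m f) (fun a b f => cmpm1 f)
    (fun a b c d h g f => cmpA h g f).

Record functor (C D : category) := Functor {
  fob :> C -> D;
  fmor : forall a b, mor a b -> mor (fob a) (fob b);
  fmor1 : forall a, fmor (idm a) = idm (fob a);
  fmorM : forall a b c (g : mor b c) (f : mor a b),
    fmor (cmp g f) = cmp (fmor g) (fmor f) }.

Arguments fmor {C D} f {a b} _ : rename.

Definition left_adjoint (C D : category) (F : functor C D) (G : functor D C)
    : Prop :=
  exists phi : forall (c : C) (d : D), mor (F c) d -> mor c (G d),
    [/\ forall c d, bijective (phi c d),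
        forall c c' d (f : mor c' c) (g : mor (F c) d),
          phi c' d (cmp g (fmor F f)) = cmp (phi c d g) f
      & forall c d d' (h : mor d d') (g : mor (F c) d),
          phi c d' (cmp h g) = cmp (fmor G h) (phi c d g)].

Section LinearMaps.
Variable K : fieldType.

(* Locked, so that simplification does not unfold linear maps built from their
   underlying functions; [mklinE] is the computation rule. *)
Definition mklin (U V : lmodType K) (f : U -> V) (fl : linear f)
  : {linear U -> V} :=
  locked (HB.pack_for {linear U -> V} f
    (GRing.isLinear.Build K U V *:%R f fl)).

Lemma mklinE (U V : lmodType K) (f : U -> V) (fl : linear f) x :
  mklin fl x = f x.
Proof. by rewrite /mklin -lock. Qed.

Lemma linear_ext (U V : lmodType K) (f g : {linear U -> V}) :
  f =1 g -> f = g.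
Proof.
case: f g => [f [[f1] [f2]]] [g [[g1] [g2]]] /= /funext fg; subst g.
by rewrite (Prop_irrelevance f1 g1) (Prop_irrelevance f2 g2).
Qed.

End LinearMaps.

Arguments mklin {K U V f} fl.

Section Quotient.
Variables (K : fieldType) (V : lmodType K).

Definition is_submodule (J : set V) : Prop :=
  J 0 /\ forall a u v, J u -> J v -> J (a *: u + v).

Record submodule := Submodule {
  subm_set :> V -> Prop;
  submP : is_submodule subm_set }.

Lemma smallest_submodule (S : set V) : is_submodule (smallest is_submodule S).
Proof.
split=> [J [[J0 _] _] //|a u v Su Sv J [JP SJ]].
by apply: JP.2; [apply: Su|apply: Sv].
Qed.

Definition submodule_span (S : set V) : submodule := Submodule (smallest_submodule S).

Variable J : submodule.

Definition subm_pred : {pred V} := fun x => `[< subm_set J x >].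

Lemma subm_pred_closed : submod_closed subm_pred.
Proof.
split=> [|a u v]; rewrite !unfold_in; first exact/asboolP/(submP J).1.
by move=> /asboolP Ju /asboolP Jv; apply/asboolP/(submP J).2.
Qed.

HB.instance Definition _ := GRing.isSubmodClosed.Build K V subm_pred
  subm_pred_closed.

Definition qmod := Quotient.quot subm_pred.
HB.instance Definition _ := GRing.Zmodule.on qmod.

Definition qpi (x : V) : qmod := \pi_(Quotient.quot subm_pred)%qT x.

Lemma qpi_eq x y : (qpi x = qpi y) <-> J (x - y).
Proof.
split.
  by move/eqP; rewrite /qpi -Quotient.idealrBE => /asboolP.
by move=> Jxy; apply/eqP; rewrite /qpi -Quotient.idealrBE; apply/asboolP.
Qed.

Definition qrepr (q : qmod) : V := repr (q : Quotient.quot subm_pred).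

Lemma qpi_repr (q : qmod) : qpi (qrepr q) = q.
Proof. by rewrite /qpi reprK. Qed.

Lemma qpi_surj (q : qmod) : exists x, q = qpi x.
Proof. by exists (qrepr q); rewrite qpi_repr. Qed.

Lemma qpiD x y : qpi (x + y) = qpi x + qpi y.
Proof. exact: (@Quotient.pi_add V subm_pred). Qed.

Definition qscale (a : K) (q : qmod) : qmod :=
  qpi (a *: qrepr q).

Lemma qpiZ a x : qpi (a *: x) = qscale a (qpi x).
Proof.
apply/qpi_eq; rewrite -scalerBr -[_ *: _]addr0.
by apply: (submP J).2 (submP J).1; apply/qpi_eq; rewrite qpi_repr.
Qed.

Lemma qscaleA a b q : qscale a (qscale b q) = qscale (a * b) q.
Proof. by have [x ->] := qpi_surj q; rewrite -!qpiZ scalerA. Qed.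
Lemma qscale1 : left_id 1 qscale.
Proof. by move=> q; have [x ->] := qpi_surj q; rewrite -!qpiZ scale1r. Qed.
Lemma qscaleDr : right_distributive qscale +%R.
Proof.
move=> a q r; have [x ->] := qpi_surj q; have [y ->] := qpi_surj r.
by rewrite -qpiD -!qpiZ scalerDr qpiD.
Qed.
Lemma qscaleDl q : {morph qscale^~ q : a b / a + b}.
Proof.
by move=> a b; have [x ->] := qpi_surj q; rewrite -!qpiZ scalerDl qpiD.
Qed.

HB.instance Definition _ :=
  GRing.Zmodule_isLmodule.Build K qmod qscaleA qscale1 qscaleDr qscaleDl.

Lemma qpi_linear : linear qpi.
Proof. by move=> a x y; rewrite qpiD qpiZ. Qed.
HB.instance Definition _ := GRing.isLinear.Build K V qmod *:%R qpi qpi_linear.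

Section Lift.
Variables (W : lmodType K) (g : {linear V -> W}).
Hypothesis gJ : forall x, J x -> g x = 0.

Definition qlift_fun (q : qmod) : W :=
  g (qrepr q).

Lemma qlift_funE x : qlift_fun (qpi x) = g x.
Proof.
by apply/eqP; rewrite -subr_eq0 -linearB gJ//; apply/qpi_eq; rewrite qpi_repr.
Qed.

Lemma qlift_linear : linear qlift_fun.
Proof.
move=> a q r; have [x ->] := qpi_surj q; have [y ->] := qpi_surj r.
by rewrite -linearP !qlift_funE linearP.
Qed.

Definition qlift : {linear qmod -> W} := mklin qlift_linear.

Lemma qliftE x : qlift (qpi x) = g x.
Proof. by rewrite mklinE qlift_funE. Qed.

End Lift.

End Quotient.

Arguments qrepr {K V J} q.
Arguments qlift {K V J W} g gJ.

Section DirectSum.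
Variables (K : fieldType) (I : choiceType) (M : I -> lmodType K).

(* The direct sum of the [M i]: families of finite support. *)
Record dsum := DSum {
  dsum_fun :> forall i, M i;
  dsumP : finite_set [set i | dsum_fun i != 0] }.

HB.instance Definition _ := gen_eqMixin dsum.
HB.instance Definition _ := gen_choiceMixin dsum.

Lemma dsum_ext (x y : dsum) : (forall i, x i = y i) -> x = y.
Proof.
case: x y => [x xP] [y yP] /= xy.
have {}xy : x = y by apply: functional_extensionality_dep.
by subst y; rewrite (Prop_irrelevance xP yP).
Qed.

Lemma dsum_fin0 : finite_set [set i | (0 : M i) != 0].
Proof. by apply: (sub_finite_set _ (finite_set0 I)) => i /=; rewrite eqxx. Qed.
Definition dsum0 : dsum := DSum dsum_fin0.

Lemma dsum_finN (x : dsum) : finite_set [set i | - x i != 0].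
Proof. by apply: (sub_finite_set _ (dsumP x)) => i /=; rewrite oppr_eq0. Qed.
Definition dsumN (x : dsum) : dsum := DSum (dsum_finN x).

Lemma dsum_finD (x y : dsum) : finite_set [set i | x i + y i != 0].
Proof.
apply: (@sub_finite_set _ _ ([set i | x i != 0] `|` [set i | y i != 0])).
  move=> i /=; case: (eqVneq (x i) 0) => [->|]; last by left.
  by rewrite add0r; right.
by rewrite finite_setU; split; apply: dsumP.
Qed.
Definition dsumD (x y : dsum) : dsum := DSum (dsum_finD x y).

Lemma dsum_finZ a (x : dsum) : finite_set [set i | a *: x i != 0].
Proof.
apply: (sub_finite_set _ (dsumP x)) => i /=.
by apply: contraNneq => ->; rewrite scaler0.
Qed.
Definition dsumZ a (x : dsum) : dsum := DSum (dsum_finZ a x).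

Lemma dsumA : associative dsumD.
Proof. by move=> x y z; apply: dsum_ext => i /=; rewrite addrA. Qed.
Lemma dsumC : commutative dsumD.
Proof. by move=> x y; apply: dsum_ext => i /=; rewrite addrC. Qed.
Lemma dsum0D : left_id dsum0 dsumD.
Proof. by move=> x; apply: dsum_ext => i /=; rewrite add0r. Qed.
Lemma dsumND : left_inverse dsum0 dsumN dsumD.
Proof. by move=> x; apply: dsum_ext => i /=; rewrite addNr. Qed.

HB.instance Definition _ := GRing.isZmodule.Build dsum dsumA dsumC dsum0D dsumND.

Lemma dsumZA a b x : dsumZ a (dsumZ b x) = dsumZ (a * b) x.
Proof. by apply: dsum_ext => i /=; rewrite scalerA. Qed.
Lemma dsumZ1 : left_id 1 dsumZ.
Proof. by move=> x; apply: dsum_ext => i /=; rewrite scale1r. Qed.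
Lemma dsumZDr : right_distributive dsumZ +%R.
Proof. by move=> a x y; apply: dsum_ext => i /=; rewrite scalerDr. Qed.
Lemma dsumZDl x : {morph dsumZ^~ x : a b / a + b}.
Proof. by move=> a b; apply: dsum_ext => i /=; rewrite scalerDl. Qed.

HB.instance Definition _ :=
  GRing.Zmodule_isLmodule.Build K dsum dsumZA dsumZ1 dsumZDr dsumZDl.

Definition dsum_single i (m : M i) : forall j, M j :=
  dfwith (fun j => 0 : M j) m.

Lemma dsum_singleE i (m : M i) : dsum_single m i = m.
Proof. exact: dfwith_in. Qed.

Lemma dsum_single0 i (m : M i) j : i <> j -> dsum_single m j = 0.
Proof. by move=> /eqP ij; apply: dfwith_out. Qed.

Lemma dsum_fin_single i (m : M i) : finite_set [set j | dsum_single m j != 0].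
Proof.
apply: (sub_finite_set _ (finite_set1 i)) => j /=.
by case: (pselect (i = j)) => // ij; rewrite dsum_single0// eqxx.
Qed.

Definition dsin_fun i (m : M i) : dsum := DSum (dsum_fin_single m).

Lemma dsin_linear i : linear (@dsin_fun i).
Proof.
move=> a m m'; apply: dsum_ext => j /=.
case: (pselect (i = j)) => [<-|ij]; first by rewrite !dsum_singleE.
by rewrite !dsum_single0// scaler0 addr0.
Qed.

Definition dsin i : {linear M i -> dsum} := mklin (@dsin_linear i).

Lemma dsin_same i (m : M i) : dsin i m i = m.
Proof. by rewrite mklinE /= dsum_singleE. Qed.

Lemma dsin_other i (m : M i) j : i <> j -> dsin i m j = 0.
Proof. by rewrite mklinE; apply: dsum_single0. Qed.

Section Lift.
Variables (W : lmodType K) (f : forall i, {linear M i -> W}).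

Definition dslift_fun (x : dsum) : W := \sum_(i \in [set: I]) f i (x i).

Lemma dslift_funE (x : dsum) (r : seq I) : uniq r ->
  (forall i, x i != 0 -> i \in r) -> dslift_fun x = \sum_(i <- r) f i (x i).
Proof.
move=> ur xr; rewrite /dslift_fun (fsbigE r)//.
  by apply: eq_bigl => i; rewrite in_setT.
move=> i _ ir; have [->|/xr] := eqVneq (x i) 0; first by rewrite linear0.
by rewrite (negPf ir).
Qed.

Lemma dsum_supp (x : dsum) : exists2 r : seq I, uniq r &
  forall i, x i != 0 -> i \in r.
Proof.
have /finite_seqP[r xr] := dsumP x.
exists (undup r) => [|i xi]; first exact: undup_uniq.
by rewrite mem_undup; have : [set` r] i by rewrite -xr.
Qed.

Lemma dslift_linear : linear dslift_fun.
Proof.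
move=> a x y; have [r _ xr] := dsum_supp x; have [s _ ys] := dsum_supp y.
rewrite !(@dslift_funE _ (undup (r ++ s))) ?undup_uniq//.
- rewrite scaler_sumr -big_split/=; apply: eq_bigr => i _.
  by rewrite linearP.
- by move=> i /ys; rewrite mem_undup mem_cat orbC => ->.
- by move=> i /xr; rewrite mem_undup mem_cat => ->.
move=> i; rewrite mem_undup mem_cat /=.
case: (eqVneq (x i) 0) => [->|/xr ->//].
by rewrite scaler0 add0r => /ys ->; rewrite orbT.
Qed.

Definition dslift : {linear dsum -> W} := mklin dslift_linear.

Lemma dsliftE i m : dslift (dsin i m) = f i m.
Proof.
rewrite !mklinE (@dslift_funE _ [:: i])//; last first.
  move=> j; rewrite inE /=; case: (eqVneq j i) => // /eqP ji.
  by rewrite dsum_single0 ?eqxx// => ij; apply: ji.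
by rewrite big_seq1 /= dsum_singleE.
Qed.

End Lift.

Lemma dsum_decomp (x : dsum) : exists r : seq I, x = \sum_(i <- r) dsin i (x i).
Proof.
have [r ur xr] := dsum_supp x; exists r; apply: dsum_ext => j.
have sumE (s : seq I) (F : I -> dsum) :
    (\sum_(i <- s) F i : dsum) j = \sum_(i <- s) F i j.
  by elim: s => [|i s IH]; rewrite ?big_nil// !big_cons -IH.
rewrite sumE; have [jr|jr] := boolP (j \in r).
  rewrite (bigD1_seq j)//= dsin_same big1 ?addr0// => i ij.
  by rewrite dsin_other//; apply/eqP.
rewrite big_seq big1 => [|i ir].
  by apply/eqP; apply: contraNT jr; apply: xr.
by rewrite dsin_other// => ij; rewrite -ij ir in jr.
Qed.

Lemma dsum_linear_ext (W : lmodType K) (f g : {linear dsum -> W}) :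
  (forall i m, f (dsin i m) = g (dsin i m)) -> f =1 g.
Proof.
move=> fg x; have [r ->] := dsum_decomp x.
by rewrite !linear_sum; apply: eq_bigr => i _.
Qed.

End DirectSum.

Arguments dsum {K I} M.
Arguments dsin {K I M} i.
Arguments dslift {K I M W} f.

Section FreeModule.
Variables (K : fieldType) (X : choiceType).

Definition freemod : lmodType K := dsum (fun _ : X => (K^o : lmodType K)).

Definition fbasis (x : X) : freemod := dsin x 1.

Section Lift.
Variables (W : lmodType K) (f : X -> W).

Lemma scale_linear (w : W) : linear (fun c : K^o => c *: w).
Proof. by move=> a b c; rewrite scalerDl scalerA. Qed.

Definition flift : {linear freemod -> W} :=
  dslift (fun x => mklin (scale_linear (f x))).

Lemma fliftE x : flift (fbasis x) = f x.
Proof. by rewrite /flift dsliftE mklinE scale1r. Qed.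

End Lift.

Lemma freemod_linear_ext (W : lmodType K) (f g : {linear freemod -> W}) :
  (forall x, f (fbasis x) = g (fbasis x)) -> f =1 g.
Proof.
move=> fg; apply: dsum_linear_ext => x c.
have -> : c = c *: (1 : K^o) by rewrite /GRing.scale /= mulr1.
by rewrite !linearZ /= -/(fbasis x) fg.
Qed.

End FreeModule.

Definition upd (n : nat) (V : Type) (x : 'I_n -> V) (i : 'I_n) (u : V)
  : 'I_n -> V := fun j => if j == i then u else x j.

Section TensorPower.
Variables (K : fieldType) (n : nat) (V : lmodType K).

Definition multilinear (W : lmodType K) (f : ('I_n -> V) -> W) : Prop :=
  forall x i a u v,
    f (upd x i (a *: u + v)) = a *: f (upd x i u) + f (upd x i v).

Notation tuples := ('I_n -> V).

(* The n-th tensor power of [V], as the free module on ['I_n -> V] modulo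
   multilinearity; [tens x] below is the pure tensor of the [x i]. *)
Definition tensor_relations : submodule (freemod K tuples) :=
  submodule_span [set r | exists (x : tuples) i a u v,
    r = fbasis K (upd x i (a *: u + v))
        - (a *: fbasis K (upd x i u) + fbasis K (upd x i v))].

Definition tpow : lmodType K := qmod tensor_relations.

Definition tens (x : tuples) : tpow := qpi tensor_relations (fbasis K x).

Lemma tens_multilinear : multilinear tens.
Proof.
move=> x i a u v; rewrite /tens -linearP; apply/qpi_eq.
by apply: sub_gen_smallest; exists x, i, a, u, v.
Qed.

Section Lift.
Variables (W : lmodType K) (f : tuples -> W) (fm : multilinear f).

Lemma tlift_relations r : tensor_relations r -> flift f r = 0.
Proof.
apply: (@smallest_sub _ _ _ [set r | flift f r = 0]).
  split=> [|a u v /= u0 v0]; first exact: linear0.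
 by rewrite linearP u0 v0 scaler0 addr0.
move=> _ [x [i [a [u [v ->]]]]] /=.
by rewrite linearB linearP !fliftE fm subrr.
Qed.

Definition tlift : {linear tpow -> W} := qlift (flift f) tlift_relations.

Lemma tliftE x : tlift (tens x) = f x.
Proof. by rewrite /tlift qliftE fliftE. Qed.

End Lift.

Lemma tpow_linear_ext (W : lmodType K) (f g : {linear tpow -> W}) :
  (forall x, f (tens x) = g (tens x)) -> f =1 g.
Proof.
move=> fg q; have [x ->] := qpi_surj q.
by apply: (@freemod_linear_ext _ _ _ (f \o qpi tensor_relations)
  (g \o qpi tensor_relations)) => y; exact: fg.
Qed.

End TensorPower.

Arguments tens {K n V} x.
Arguments tlift {K n V W} f fm.

Record homNonAs (K : fieldType) := HomNonAs {
  hcarrier :> lmodType K;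
  hmul : {bilinear hcarrier -> hcarrier -> hcarrier};
  htwist : {linear hcarrier -> hcarrier} }.

Arguments hmul {K A} : rename.
Arguments htwist {K A} : rename.

Section HomNonAsCategory.
Variable K : fieldType.

Record hmorphism (A B : homNonAs K) := HMorphism {
  hmap :> {linear A -> B};
  hmap_twist : forall x, htwist (hmap x) = hmap (htwist x);
  hmap_mul : forall x y, hmap (hmul x y) = hmul (hmap x) (hmap y) }.

Lemma hmorphism_ext (A B : homNonAs K) (f g : hmorphism A B) : f =1 g -> f = g.
Proof.
case: f g => [f f1 f2] [g g1 g2] /= /linear_ext fg; subst g.
by rewrite (Prop_irrelevance f1 g1) (Prop_irrelevance f2 g2).
Qed.

Definition hid (A : homNonAs K) : hmorphism A A :=
  @HMorphism A A idfun (fun=> erefl) (fun _ _ => erefl).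

Section Comp.
Variables (A B C : homNonAs K) (g : hmorphism B C) (f : hmorphism A B).

Lemma hcomp_twist x : htwist ((g \o f) x) = (g \o f) (htwist x).
Proof. by rewrite /= !hmap_twist. Qed.

Lemma hcomp_mul x y : (g \o f) (hmul x y) = hmul ((g \o f) x) ((g \o f) y).
Proof. by rewrite /= !hmap_mul. Qed.

Definition hcomp : hmorphism A C :=
  @HMorphism A C (g \o f) hcomp_twist hcomp_mul.

End Comp.

Definition HomNonAsCat : category.
Proof.
apply: (@Category (homNonAs K) hmorphism hid hcomp).
- by move=> *; apply: hmorphism_ext.
- by move=> *; apply: hmorphism_ext.
- by move=> *; apply: hmorphism_ext.
Defined.

Definition hom_associative (A : homNonAs K) : Prop :=
  forall x y z : A,
    hmul (htwist x) (hmul y z) = hmul (hmul x y) (htwist z).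

Definition hom_lie (L : homNonAs K) : Prop :=
  (forall x y : L, hmul x y = - hmul y x) /\
  (forall x y z : L,
    0 = hmul (htwist x) (hmul y z) + hmul (htwist z) (hmul x y)
        + hmul (htwist y) (hmul z x)).

Definition HomAs : category := @full_subcategory HomNonAsCat hom_associative.
Definition HomLie : category := @full_subcategory HomNonAsCat hom_lie.

End HomNonAsCategory.

Section Bilinear.
Variables (K : fieldType) (U V W : lmodType K) (f : U -> V -> W).

Definition mkbilinear (fl : forall v, linear (f ^~ v))
    (fr : forall u, linear (f u)) : {bilinear U -> V -> W} :=
  locked (HB.pack_for {bilinear U -> V -> W} f
    (bilinear_isBilinear.Build K U V W *:%R *:%R f (fl, fr))).

Lemma mkbilinearE fl fr u v : mkbilinear fl fr u v = f u v.
Proof. by rewrite /mkbilinear -lock. Qed.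

End Bilinear.

Lemma bilinearPr (K : fieldType) (U V W : lmodType K)
  (b : {bilinear U -> V -> W}) u : linear (b u).
Proof. by move=> a x y; rewrite linearPr. Qed.

Lemma bilinearPl (K : fieldType) (U V W : lmodType K)
  (b : {bilinear U -> V -> W}) v : linear (b ^~ v).
Proof. by move=> a x y; rewrite linearPl. Qed.

Section Commutator.
Variables (K : fieldType) (A : homNonAs K).

Definition commutator (x y : A) : A := hmul x y - hmul y x.

Lemma commutator_linl y : linear (commutator ^~ y).
Proof.
move=> a u v; rewrite /commutator linearPl linearPr.
by rewrite scalerBr opprD addrACA.
Qed.

Lemma commutator_linr x : linear (commutator x).
Proof.
move=> a u v; rewrite /commutator linearPl linearPr.
by rewrite scalerBr opprD addrACA.
Qed.

Definition hlie : homNonAs K :=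
  @HomNonAs K A (mkbilinear commutator_linl commutator_linr) htwist.

Lemma hlie_mulE (x y : A) : @hmul K hlie x y = hmul x y - hmul y x.
Proof. exact: mkbilinearE. Qed.

End Commutator.

Section CommutatorFunctor.
Variable K : fieldType.

Lemma hlie_hom_lie (A : homNonAs K) : hom_associative A -> hom_lie (hlie A).
Proof.
move=> asA; split=> [x y|x y z]; rewrite !hlie_mulE ?opprB//.
rewrite !linearBr !linearBl !asA !opprB.
rewrite [RHS](AC ((2*2)*(2*2)*(2*2))
  ((1*8)*(2*11)*(3*6)*(4*9)*(5*12)*(7*10))).
by rewrite /= !(subrr, addNr, addr0).
Qed.

Definition hlie_mor (A B : homNonAs K) (f : hmorphism A B)
  : hmorphism (hlie A) (hlie B).
Proof.
apply: (@HMorphism K (hlie A) (hlie B) f (hmap_twist f)) => x y.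
by rewrite !hlie_mulE linearB !hmap_mul.
Defined.

Definition HLie : functor (HomAs K) (HomLie K).
Proof.
apply: (@Functor (HomAs K) (HomLie K)
  (fun A => exist _ (hlie (sval A)) (hlie_hom_lie (svalP A)))
  (fun A B f => hlie_mor f)).
- by move=> A; apply: hmorphism_ext.
- by move=> A B C g f; apply: hmorphism_ext.
Defined.

End CommutatorFunctor.

(* [wtree] is the disjoint union over n >= 1 of the sets of weighted n-trees
   (psi, w), n being recovered by [leaves]: the weight of an internal vertex is
   stored in the corresponding [Node]. *)
Inductive wtree := Leaf | Node of nat & wtree & wtree.

HB.instance Definition _ := gen_eqMixin wtree.
HB.instance Definition _ := gen_choiceMixin wtree.

Fixpoint leaves (t : wtree) : nat :=
  if t is Node _ l r then (leaves l + leaves r)%N else 1%N.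

Definition graft (l r : wtree) : wtree := Node 0 l r.

(* tau[m]. A leaf has no internal vertex; that case is not used. *)
Definition add_weight (m : nat) (t : wtree) : wtree :=
  if t is Node k l r then Node (k + m)%N l r else Leaf.

Section TensorOperations.
Variable K : fieldType.

Definition cattup (V : Type) p q (x : 'I_p -> V) (y : 'I_q -> V)
    : 'I_(p + q) -> V :=
  fun i => match fintype.split i with inl j => x j | inr k => y k end.

Lemma cattup_updl (V : Type) p q (x : 'I_p -> V) (y : 'I_q -> V) i u :
  cattup (upd x i u) y = upd (cattup x y) (lshift q i) u.
Proof.
apply/funext => k; rewrite /cattup /upd; case: (split_ordP k) => j ->.
  by rewrite eq_lshift.
by rewrite eq_rlshift.
Qed.

Lemma cattup_updr (V : Type) p q (x : 'I_p -> V) (y : 'I_q -> V) i u :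
  cattup x (upd y i u) = upd (cattup x y) (rshift p i) u.
Proof.
apply/funext => k; rewrite /cattup /upd; case: (split_ordP k) => j ->.
  by rewrite eq_lrshift.
by rewrite eq_rshift.
Qed.

Section Concat.
Variables (V : lmodType K) (p q : nat).

Lemma tcatr_multilinear (x : 'I_p -> V) :
  multilinear (fun y : 'I_q -> V => tens (K := K) (cattup x y)).
Proof. by move=> y i a u v; rewrite !cattup_updr tens_multilinear. Qed.

Definition tcatr (x : 'I_p -> V) : {linear tpow q V -> tpow (p + q)%N V} :=
  tlift _ (tcatr_multilinear x).

Lemma tcatl_multilinear (b : tpow q V) : multilinear (fun x => tcatr x b).
Proof.
move=> x i a u v; move: b; apply: (@tpow_linear_ext _ _ _ _ _
  ((a \*: tcatr (upd x i u)) \+ tcatr (upd x i v))) => y /=.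
by rewrite !tliftE !cattup_updl tens_multilinear.
Qed.

Definition tcat_fun (a : tpow p V) (b : tpow q V) : tpow (p + q)%N V :=
  tlift _ (tcatl_multilinear b) a.

Lemma tcat_linl b : linear (tcat_fun ^~ b).
Proof. exact: linearP. Qed.

Lemma tcat_linr a : linear (tcat_fun a).
Proof.
move=> c b b'; rewrite /tcat_fun; move: a; apply: (@tpow_linear_ext _ _ _ _ _
  ((c \*: tlift _ (tcatl_multilinear b)) \+
   tlift _ (tcatl_multilinear b'))) => x /=.
by rewrite !tliftE linearP.
Qed.

Definition tcat : {bilinear tpow p V -> tpow q V -> tpow (p + q)%N V} :=
  mkbilinear tcat_linl tcat_linr.

Lemma tcatE x y : tcat (tens x) (tens y) = tens (cattup x y).
Proof. by rewrite mkbilinearE /tcat_fun !tliftE. Qed.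

End Concat.

Section Map.
Variables (V W : lmodType K) (f : {linear V -> W}) (n : nat).

Lemma tmap_multilinear :
  multilinear (fun x : 'I_n -> V => tens (K := K) (f \o x)).
Proof.
have updE x i u : f \o upd x i u = upd (f \o x) i (f u) :> ('I_n -> W).
  by apply/funext => j; rewrite /upd /=; case: ifP.
by move=> x i a u v; rewrite !updE linearP tens_multilinear.
Qed.

Definition tmap : {linear tpow n V -> tpow n W} := tlift _ tmap_multilinear.

Lemma tmapE x : tmap (tens x) = tens (f \o x).
Proof. exact: tliftE. Qed.

End Map.

End TensorOperations.

Section FreeHomNonAs.
Variables (K : fieldType).

(* Summing over all weighted trees at once amounts to summing over n >= 1 and
   then over the weighted n-trees. *)
Definition freeNAs (V : lmodType K) : lmodType K :=
  dsum (fun t : wtree => tpow (leaves t) V).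

Definition fgen (V : lmodType K) (t : wtree) (x : 'I_(leaves t) -> V)
  : freeNAs V := dsin t (tens x).

Lemma freeNAs_linear_ext (V W : lmodType K) (f g : {linear freeNAs V -> W}) :
  (forall t (x : 'I_(leaves t) -> V), f (fgen x) = g (fgen x)) -> f =1 g.
Proof.
move=> fg; apply: dsum_linear_ext => t.
by apply: (@tpow_linear_ext _ _ _ _ (f \o dsin t) (g \o dsin t)) => x; exact: fg.
Qed.

Definition finj_fun (V : lmodType K) (v : V) : freeNAs V :=
  @fgen V Leaf (fun=> v).

Lemma finj_linear (V : lmodType K) : linear (@finj_fun V).
Proof.
move=> a u v; rewrite /finj_fun /fgen -linearP; congr (dsin _ _).
have updE w : (fun=> w) = upd (fun=> 0 : V) ord0 w :> ('I_1 -> V).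
  by apply/funext => j; rewrite /upd (ord1 j).
by rewrite /= [LHS](congr1 (@tens K 1 V) (updE _)) tens_multilinear -!updE.
Qed.

Definition finj (V : lmodType K) : {linear V -> freeNAs V} :=
  mklin (@finj_linear V).

Section Product.
Variable V : lmodType K.

Definition fmulr t (a : tpow (leaves t) V)
  : {linear freeNAs V -> freeNAs V} :=
  dslift (fun s =>
    (dsin (graft t s) : {linear tpow (leaves t + leaves s)%N V -> freeNAs V})
    \o tcat V (leaves t) (leaves s) a).

Lemma fmulr_linear t y : linear (fun a => @fmulr t a y).
Proof.
move=> c a b; move: y; apply: (@dsum_linear_ext _ _ _ _ _
  ((c \*: fmulr a) \+ fmulr b)) => s m /=.
by rewrite !dsliftE /= linearPl linearP.
Qed.

Definition fmul_fun (x y : freeNAs V) : freeNAs V :=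
  dslift (fun t => mklin (@fmulr_linear t y)) x.

Lemma fmul_linl y : linear (fmul_fun ^~ y).
Proof. exact: linearP. Qed.

Lemma fmul_linr x : linear (fmul_fun x).
Proof.
move=> c y y'; rewrite /fmul_fun; move: x; apply: (@dsum_linear_ext _ _ _ _ _
  ((c \*: dslift (fun t => mklin (@fmulr_linear t y))) \+
   dslift (fun t => mklin (@fmulr_linear t y')))) => t m /=.
by rewrite !dsliftE !(mklinE (fmulr_linear _)) linearP.
Qed.

Definition fmul : {bilinear freeNAs V -> freeNAs V -> freeNAs V} :=
  mkbilinear fmul_linl fmul_linr.

Lemma fmulE t s (x : 'I_(leaves t) -> V) (y : 'I_(leaves s) -> V) :
  fmul (fgen x) (fgen y) = @fgen V (graft t s) (cattup x y).
Proof.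
by rewrite mkbilinearE /fmul_fun dsliftE mklinE dsliftE /= tcatE.
Qed.

End Product.

Section Twist.
Variables (V : lmodType K) (alpha : {linear V -> V}).

(* On the summand of [Leaf], the first tensor power of [V], this is [alpha]. On
   the other ones it is the identity map from the summand of tau to that of
   tau[1], both being the same tensor power. *)
Definition ftwist_part (t : wtree) : {linear tpow (leaves t) V -> freeNAs V} :=
  match t return {linear tpow (leaves t) V -> freeNAs V} with
  | Leaf => dsin Leaf \o tmap alpha 1
  | Node m l r => dsin (add_weight 1 (Node m l r))
  end.

Definition ftwist : {linear freeNAs V -> freeNAs V} := dslift ftwist_part.

Lemma ftwist_leaf (x : 'I_1 -> V) :
  ftwist (@fgen V Leaf x) = @fgen V Leaf (alpha \o x).
Proof. by rewrite dsliftE /= tmapE. Qed.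

Lemma ftwist_node m l r (x : 'I_(leaves (Node m l r)) -> V) :
  ftwist (@fgen V (Node m l r) x) = @fgen V (add_weight 1 (Node m l r)) x.
Proof. by rewrite dsliftE. Qed.

Definition FHNAs : homNonAs K := @HomNonAs K (freeNAs V) (fmul V) ftwist.

End Twist.

Section FreeMap.
Variables (V W : lmodType K) (aV : {linear V -> V}) (aW : {linear W -> W}).
Variables (f : {linear V -> W}) (fa : forall v, aW (f v) = f (aV v)).

Definition fmap_lin : {linear freeNAs V -> freeNAs W} :=
  dslift (fun t => dsin t \o tmap f (leaves t)).

Lemma fmapE t (x : 'I_(leaves t) -> V) :
  fmap_lin (fgen x) = @fgen W t (f \o x).
Proof. by rewrite dsliftE /= tmapE. Qed.

Lemma fmap_twist (x : FHNAs aV) :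
  @htwist K (FHNAs aW) (fmap_lin x) = fmap_lin (htwist x).
Proof.
move: x; apply: (@freeNAs_linear_ext _ _ (ftwist aW \o fmap_lin)
  (fmap_lin \o ftwist aV)) => -[x|m l r x] /=.
  rewrite fmapE !ftwist_leaf fmapE; congr fgen.
  by apply/funext => i /=; rewrite fa.
by rewrite fmapE !ftwist_node [RHS]fmapE.
Qed.

Lemma fmap_mul (x y : FHNAs aV) :
  fmap_lin (hmul x y) = @hmul K (FHNAs aW) (fmap_lin x) (fmap_lin y).
Proof.
rewrite /=; move: x y; pose l y := mklin (bilinearPl (fmul V) y).
pose l' y := mklin (bilinearPl (fmul W) y).
move=> x y; rewrite -(mklinE (bilinearPl (fmul V) y) x).
rewrite -(mklinE (bilinearPl (fmul W) (fmap_lin y)) (fmap_lin x)).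
move: x; apply: (@freeNAs_linear_ext _ _ (fmap_lin \o l y)
  (l' (fmap_lin y) \o fmap_lin)) => t x; rewrite /= !(mklinE (bilinearPl _ _)).
move: y; apply: (@freeNAs_linear_ext _ _ (fmap_lin \o fmul V (fgen x))
  (fmul W (fmap_lin (fgen x)) \o fmap_lin)) => s y /=.
rewrite fmulE !fmapE fmulE; congr fgen; apply/funext => i.
by rewrite /cattup /=; case: fintype.split.
Qed.

Definition fmap : hmorphism (FHNAs aV) (FHNAs aW) :=
  HMorphism fmap_twist fmap_mul.

End FreeMap.
End FreeHomNonAs.

Section Ideals.
Variables (K : fieldType) (A : homNonAs K).

Definition two_sided_ideal (J : set A) : Prop :=
  is_submodule J /\ forall x y, J y -> J (hmul x y) /\ J (hmul y x).

Definition ideal_gen (S : set A) : set A := smallest two_sided_ideal S.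

Lemma ideal_genP (S : set A) : two_sided_ideal (ideal_gen S).
Proof.
split.
  split=> [J [[[J0 _] _] _] //|a u v Su Sv J JP].
  by apply: JP.1.1.2; [apply: Su|apply: Sv].
by move=> x y Sy; split=> J JP; have [] := JP.1.2 x y (Sy J JP).
Qed.

Lemma sub_ideal_gen (S : set A) : S `<=` ideal_gen S.
Proof. exact: sub_gen_smallest. Qed.

Record twist_ideal := TwistIdeal {
  tideal_set :> A -> Prop;
  tidealP : two_sided_ideal tideal_set;
  tideal_twist : forall x, tideal_set x -> tideal_set (htwist x) }.

Variable J : twist_ideal.

Definition tideal_submodule : submodule A := Submodule (tidealP J).1.

Notation Q := (qmod tideal_submodule).
Notation pi := (qpi tideal_submodule).

Lemma quot_twist0 x : tideal_submodule x -> (pi \o htwist) x = 0.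
Proof.
by move=> Jx /=; rewrite -(linear0 pi); apply/qpi_eq; rewrite subr0; exact: tideal_twist.
Qed.

Definition quot_twist : {linear Q -> Q} := qlift (pi \o htwist) quot_twist0.

Lemma quot_twistE x : quot_twist (pi x) = pi (htwist x).
Proof. by rewrite qliftE. Qed.

Definition quot_mul_fun (p q : Q) : Q :=
  pi (hmul (qrepr p) (qrepr q)).

Lemma quot_mul_funE x y : quot_mul_fun (pi x) (pi y) = pi (hmul x y).
Proof.
apply/qpi_eq.
set x' := qrepr _; set y' := qrepr _.
have -> : hmul x' y' - hmul x y = 1 *: hmul (x' - x) y' + hmul x (y' - y).
  by rewrite scale1r linearBl linearBr subrKA.
have [sJ mJ] := tidealP J.
have Jx : tideal_submodule (x' - x) by apply/qpi_eq; rewrite qpi_repr.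
have Jy : tideal_submodule (y' - y) by apply/qpi_eq; rewrite qpi_repr.
by apply: sJ.2; [case: (mJ y' _ Jx)|case: (mJ x _ Jy)].
Qed.

Lemma quot_mul_linl q : linear (quot_mul_fun ^~ q).
Proof.
move=> a u v; have [x ->] := qpi_surj u; have [y ->] := qpi_surj v.
have [z ->] := qpi_surj q.
by rewrite -linearP !quot_mul_funE linearPl linearP.
Qed.

Lemma quot_mul_linr q : linear (quot_mul_fun q).
Proof.
move=> a u v; have [x ->] := qpi_surj u; have [y ->] := qpi_surj v.
have [z ->] := qpi_surj q.
by rewrite -linearP !quot_mul_funE linearPr linearP.
Qed.

Definition hquot : homNonAs K :=
  @HomNonAs K Q (mkbilinear quot_mul_linl quot_mul_linr) quot_twist.

Lemma hpi_twist x : @htwist K hquot (pi x) = pi (htwist x).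
Proof. exact: quot_twistE. Qed.

Lemma hpi_mul x y : pi (hmul x y) = @hmul K hquot (pi x) (pi y).
Proof. by rewrite [RHS]mkbilinearE quot_mul_funE. Qed.

Definition hpi : hmorphism A hquot := @HMorphism K A hquot pi hpi_twist hpi_mul.

Section Lift.
Variables (B : homNonAs K) (g : hmorphism A B).
Hypothesis gJ : forall x, J x -> g x = 0.

Let h : {linear Q -> B} := @qlift K A tideal_submodule B g gJ.

Let hE x : h (pi x) = g x. Proof. exact: qliftE. Qed.

Lemma hlift_twist (q : hquot) : htwist (h q) = h (htwist q).
Proof.
by have [x ->] := qpi_surj q; rewrite hpi_twist !hE hmap_twist.
Qed.

Lemma hlift_mul (p q : hquot) : h (hmul p q) = hmul (h p) (h q).
Proof.
have [x ->] := qpi_surj p; have [y ->] := qpi_surj q.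
by rewrite -hpi_mul !hE hmap_mul.
Qed.

Definition hlift : hmorphism hquot B := HMorphism hlift_twist hlift_mul.

Lemma hliftE x : hlift (hpi x) = g x.
Proof. exact: hE. Qed.

End Lift.

Lemma hquot_ext (B : homNonAs K) (f g : hmorphism hquot B) :
  (forall x, f (hpi x) = g (hpi x)) -> f = g.
Proof.
by move=> fg; apply: hmorphism_ext => q; have [x ->] := qpi_surj q; exact: fg.
Qed.

End Ideals.

Lemma ideal_preimage (K : fieldType) (A B : homNonAs K) (g : hmorphism A B)
  (J : set B) : two_sided_ideal J -> two_sided_ideal (g @^-1` J).
Proof.
move=> [[J0 JP] JM]; split; last first.
  by move=> x y /=; rewrite !hmap_mul => Jy; apply: JM.
by split=> [|a u v] /=; rewrite ?linear0// linearP; apply: JP.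
Qed.

Section Associator.
Variables (K : fieldType) (A : homNonAs K).

Let i0 : 'I_3 := @Ordinal 3 0 isT.
Let i1 : 'I_3 := @Ordinal 3 1 isT.
Let i2 : 'I_3 := @Ordinal 3 2 isT.

Definition hassoc_fun (x : 'I_3 -> A) : A :=
  hmul (hmul (x i0) (x i1)) (htwist (x i2))
  - hmul (htwist (x i0)) (hmul (x i1) (x i2)).

Lemma hassoc_multilinear : multilinear hassoc_fun.
Proof.
move=> x [[|[|[|//]]] lti] a u v; rewrite /hassoc_fun /upd /=.
- by rewrite !(linearPl, linearP (@htwist K A)) scalerBr opprD addrACA.
- by rewrite linearPr !linearPl linearPr scalerBr opprD addrACA.
- by rewrite !(linearPr, linearP (@htwist K A)) scalerBr opprD addrACA.
Qed.

(* The linear map mu o (mu (x) alpha - alpha (x) mu) on the third tensor power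
   of [A]. *)
Definition hassociator : {linear tpow 3 A -> A} := tlift _ hassoc_multilinear.

Lemma hassociatorE x y z : hmul (hmul x y) (htwist z) - hmul (htwist x) (hmul y z)
  = hassociator (tens (fun i : 'I_3 => nth 0 [:: x; y; z] i)).
Proof. by rewrite tliftE. Qed.

End Associator.

Lemma hassociator_morph (K : fieldType) (A B : homNonAs K) (g : hmorphism A B) :
  forall t, g (hassociator A t) = hassociator B (tmap g 3 t).
Proof.
apply: (@tpow_linear_ext _ _ _ _ (g \o hassociator A)
  (hassociator B \o tmap g 3)) => x /=.
by rewrite tmapE !tliftE /hassoc_fun linearB !hmap_mul /= !hmap_twist.
Qed.

Section Enveloping.
Variables (K : fieldType) (L : homNonAs K).

Definition freeOn : homNonAs K := FHNAs (@htwist K L).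

Definition fincl (x : L) : freeOn := finj L x.

Definition env_generators : set freeOn :=
  range (hassociator freeOn) `|`
  [set r | exists x y : L,
    r = fincl (hmul x y)
        - (hmul (fincl x) (fincl y) - hmul (fincl y) (fincl x))].

(* Indices are shifted by one: [env_ideal n] is the ideal I^(n+1). *)
Fixpoint env_ideal (n : nat) : set freeOn :=
  if n is m.+1 then
    ideal_gen (env_ideal m `|` [set htwist x | x in env_ideal m])
  else ideal_gen env_generators.

Definition env_ideal_oo : set freeOn := \bigcup_n env_ideal n.

Lemma env_idealP n : two_sided_ideal (env_ideal n).
Proof. by case: n => [|n]; apply: ideal_genP. Qed.

Lemma env_idealS n : env_ideal n `<=` env_ideal n.+1.
Proof. by move=> x Ix; apply: sub_ideal_gen; left. Qed.

Lemma env_ideal_le m n : (m <= n)%N -> env_ideal m `<=` env_ideal n.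
Proof.
elim: n => [|n IH]; first by rewrite leqn0 => /eqP ->.
rewrite leq_eqVlt => /predU1P[->//|]; rewrite ltnS => /IH mn.
exact: subset_trans mn (@env_idealS n).
Qed.

Lemma env_ideal_ooP : two_sided_ideal env_ideal_oo.
Proof.
split; last first.
  move=> x y [n _ Iy]; have [_ /(_ x y Iy)[Il Ir]] := env_idealP n.
  by split; exists n.
split=> [|a u v [m _ Iu] [n _ Iv]].
  by have [[I0 _] _] := env_idealP 0; exists 0%N.
exists (maxn m n) => //; apply: (env_idealP (maxn m n)).1.2.
  exact: env_ideal_le (leq_maxl m n) _ Iu.
exact: env_ideal_le (leq_maxr m n) _ Iv.
Qed.

Lemma env_ideal_oo_twist x : env_ideal_oo x -> env_ideal_oo (htwist x).
Proof.
by move=> [n _ Ix]; exists n.+1 => //; apply: sub_ideal_gen; right; exists x.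
Qed.

Definition env_twist_ideal : twist_ideal freeOn :=
  TwistIdeal env_ideal_ooP env_ideal_oo_twist.

Definition env : homNonAs K := hquot env_twist_ideal.

Lemma env_hom_associative : hom_associative env.
Proof.
move=> p q r; have [x ->] := qpi_surj p; have [y ->] := qpi_surj q.
have [z ->] := qpi_surj r.
rewrite !hpi_twist -!hpi_mul; apply/esym/qpi_eq; rewrite hassociatorE.
by exists 0%N => //; apply: sub_ideal_gen; left; exists (tens (fun i : 'I_3 => nth 0 [:: x; y; z] i)).
Qed.

End Enveloping.

Section EnvelopingMap.
Variables (K : fieldType) (L L' : homNonAs K) (f : hmorphism L L').

Definition free_map : hmorphism (freeOn L) (freeOn L') := fmap (hmap_twist f).

Lemma free_map_incl x : free_map (fincl x) = fincl (f x).
Proof. by rewrite /fincl !(mklinE (@finj_linear _ _)) /finj_fun /= fmapE. Qed.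

Lemma free_map_ideal x : env_ideal_oo x -> env_ideal_oo (free_map x).
Proof.
move=> [n _ Ix]; exists n => //; elim: n x Ix => [|n IH].
  apply: smallest_sub; first exact/ideal_preimage/env_idealP.
  move=> _ [[t _ <-]|[x [y ->]]]; apply: sub_ideal_gen.
    by left; rewrite hassociator_morph; exists (tmap free_map 3 t).
  right; exists (f x), (f y).
  by rewrite !linearB !hmap_mul !free_map_incl hmap_mul.
apply: smallest_sub; first exact/ideal_preimage/env_idealP.
move=> z [Iz|[x Ix <-]]; apply: sub_ideal_gen; first by left; apply: IH.
by right; exists (free_map x); [apply: IH|rewrite hmap_twist].
Qed.

Lemma env_map0 x : env_twist_ideal L x -> hcomp (hpi (env_twist_ideal L')) free_map x = 0.
Proof.
move=> /free_map_ideal Ix.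
rewrite -(linear0 (hpi (env_twist_ideal L'))); apply/qpi_eq.
by rewrite subr0.
Qed.

Definition env_map : hmorphism (env L) (env L') := hlift env_map0.

Lemma env_mapE x : env_map (hpi (env_twist_ideal L) x)
  = hpi (env_twist_ideal L') (free_map x).
Proof. by rewrite /env_map hliftE. Qed.

End EnvelopingMap.

Section EnvelopingFunctor.
Variable K : fieldType.

Lemma env_map1 (L : homNonAs K) : env_map (hid L) = hid (env L).
Proof.
apply: hquot_ext => x; rewrite env_mapE /=; congr (qpi _ _).
move: x; apply: (@freeNAs_linear_ext _ _ _ (free_map (hid L)) idfun) => t x.
by rewrite /= fmapE.
Qed.

Lemma env_mapM (L M N : homNonAs K) (g : hmorphism M N) (f : hmorphism L M) :
  env_map (hcomp g f) = hcomp (env_map g) (env_map f).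
Proof.
apply: hquot_ext => x.
have -> : hcomp (env_map g) (env_map f) (hpi (env_twist_ideal L) x)
   = env_map g (env_map f (hpi (env_twist_ideal L) x)) by [].
rewrite !env_mapE; congr (hpi _ _).
move: x; apply: (@freeNAs_linear_ext _ _ _ (free_map (hcomp g f))
  (free_map g \o free_map f)) => t x.
by rewrite /= !fmapE.
Qed.

Definition UHLie : functor (HomLie K) (HomAs K) :=
  @Functor (HomLie K) (HomAs K)
    (fun L => exist _ (env (sval L)) (@env_hom_associative K (sval L)))
    (fun L L' f => env_map f)
    (fun L => env_map1 (sval L)) (fun L M N g f => env_mapM g f).

End EnvelopingFunctor.

(* Main.v *)
(** The unit [L -> HLie (UHLie L)] is the class of the inclusion of generators.
It is universal because a weighted tree is evaluated in any Hom-nonassociative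
algebra by reading a node of weight [m] as the product of its two branches
twisted [m] times; every morphism out of the free algebra is this evaluation,
and the one extending a Hom-Lie morphism [L -> HLie A] kills each I^n, by
induction on n, since its kernel is an ideal closed under the twist. *)

Require Import Defs.
From mathcomp Require Import all_boot all_order all_algebra.
From mathcomp Require Import boolp classical_sets functions.

Set Implicit Arguments.
Unset Strict Implicit.
Unset Printing Implicit Defensive.

Import GRing.Theory.
Local Open Scope ring_scope.

Section TreeEvaluation.
Variables (K : fieldType) (A : homNonAs K).

Fixpoint teval (t : wtree) : ('I_(leaves t) -> A) -> A :=
  match t return ('I_(leaves t) -> A) -> A with
  | Leaf => fun x => x ord0
  | Node m l r => fun x => iter m htwist
      (hmul (@teval l (x \o @lshift (leaves l) (leaves r))) (@teval r (x \o @rshift (leaves l) (leaves r))))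
  end.
Arguments teval : clear implicits.

Lemma iter_htwist_linear m : linear (iter m (@htwist K A)).
Proof. by elim: m => [|m IH] a u v //=; rewrite IH linearP. Qed.

(** Each leaf lies in exactly one branch, so changing one argument affects a single factor of the
    bilinear product at the root. *)
Lemma teval_multilinear t : multilinear (teval t).
Proof.
elim: t => [|m l IHl r IHr] x i a u v /=.
  by rewrite (ord1 i) /upd eqxx.
rewrite -iter_htwist_linear; congr (iter m _ _).
have updll j w : upd x (lshift (leaves r) j) w \o @lshift (leaves l) (leaves r)
    = upd (x \o @lshift (leaves l) (leaves r)) j w.
  by apply/funext => k; rewrite /upd /= eq_lshift.
have updlr j w : upd x (lshift (leaves r) j) w \o @rshift (leaves l) (leaves r)
    = x \o @rshift (leaves l) (leaves r).
  by apply/funext => k; rewrite /upd /= eq_rlshift.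
have updrl j w : upd x (rshift (leaves l) j) w \o @lshift (leaves l) (leaves r)
    = x \o @lshift (leaves l) (leaves r).
  by apply/funext => k; rewrite /upd /= eq_lrshift.
have updrr j w : upd x (rshift (leaves l) j) w \o @rshift (leaves l) (leaves r)
    = upd (x \o @rshift (leaves l) (leaves r)) j w.
  by apply/funext => k; rewrite /upd /= eq_rshift.
case: (split_ordP i) => j ->.
  by rewrite !updll !updlr IHl linearPl.
by rewrite !updrl !updrr IHr linearPr.
Qed.

Section FreeLift.
Variables (V : lmodType K) (f : {linear V -> A}).

Lemma teval_comp_multilinear t :
  multilinear (fun x : 'I_(leaves t) -> V => teval t (f \o x)).
Proof.
have updE n (x : 'I_n -> V) i u : f \o upd x i u = upd (f \o x) i (f u).
  by apply/funext => j; rewrite /upd /=; case: ifP.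
by move=> x i a u v; rewrite !updE linearP teval_multilinear.
Qed.

Definition free_lift : {linear freeNAs V -> A} :=
  dslift (fun t => tlift _ (@teval_comp_multilinear t)).

Lemma free_liftE t (x : 'I_(leaves t) -> V) :
  free_lift (fgen x) = teval t (f \o x).
Proof. by rewrite dsliftE tliftE. Qed.

Lemma free_lift_mul x y :
  free_lift (fmul V x y) = hmul (free_lift x) (free_lift y).
Proof.
(* Both sides become bundled linear maps of [x], so that they can be compared on generators; [y] is
   treated likewise afterwards. *)
rewrite -(mklinE (bilinearPl (fmul V) y) x).
rewrite -(mklinE (bilinearPl (@hmul K A) (free_lift y)) (free_lift x)).
move: x; apply: (@freeNAs_linear_ext _ _ _
  (free_lift \o mklin (bilinearPl (fmul V) y))
  (mklin (bilinearPl (@hmul K A) (free_lift y)) \o free_lift)) => t x /=.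
rewrite !(mklinE (bilinearPl _ _)); move: y; apply: (@freeNAs_linear_ext _ _ _
  (free_lift \o fmul V (fgen x))
  (hmul (free_lift (fgen x)) \o free_lift)) => s y /=.
(* A graft has root weight 0, so no twist is applied; it remains to cut the concatenated tuple back
   into its halves. *)
rewrite fmulE !free_liftE /=; congr (hmul _ _); congr (teval _ _).
  by apply/funext => i; rewrite /cattup /= -[lshift _ i]/(unsplit (inl i)) unsplitK.
by apply/funext => i; rewrite /cattup /= -[rshift _ i]/(unsplit (inr i)) unsplitK.
Qed.

Variable alpha : {linear V -> V}.
Hypothesis f_twist : forall v, htwist (f v) = f (alpha v).

(** On a leaf this is [f_twist]; on a node the extra unit of weight is one more iterate of
    [htwist]. *)
Lemma free_lift_twist x :
  htwist (free_lift x) = free_lift (ftwist alpha x).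
Proof.
move: x; apply: (@freeNAs_linear_ext _ _ _ (htwist \o free_lift)
  (free_lift \o ftwist alpha)) => -[|m l r] x /=.
  by rewrite ftwist_leaf !free_liftE /= f_twist.
by rewrite ftwist_node !free_liftE /= addn1.
Qed.

Definition free_hlift : hmorphism (FHNAs alpha) A :=
  @HMorphism K (FHNAs alpha) A free_lift free_lift_twist free_lift_mul.

Lemma free_hlift_incl v : free_hlift (finj V v) = f v.
Proof. by rewrite (mklinE (@finj_linear _ _)) /= free_liftE. Qed.

End FreeLift.

(** Generators arise from leaves by grafting and twisting, which [h] respects; this is the
    uniqueness half of freeness. *)
Lemma free_hmorphism_teval (V : lmodType K) (alpha : {linear V -> V})
    (h : hmorphism (FHNAs alpha) A) t (x : 'I_(leaves t) -> V) :
  h (fgen x) = teval t (fun i => h (finj V (x i))).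
Proof.
elim: t x => [|m l IHl r IHr] x.
  rewrite /= (mklinE (@finj_linear _ _)); congr (h (dsin Leaf (tens _))).
  by apply/funext => i; rewrite (ord1 i).
(* Weight 0 is a graft of the two branches; each further unit of weight is one application of the
   twist. *)
elim: m => [|m IHm] in x *.
  rewrite /= -[teval l _]IHl -[teval r _]IHr -hmap_mul /= fmulE.
  congr (h (dsin _ (tens _))); apply/funext => i.
  by rewrite /cattup; case: (split_ordP i) => j ->.
by rewrite [RHS]/= -[iter m _ _]IHm hmap_twist /= ftwist_node /= addn1.
Qed.

Lemma free_hmorphism_ext (V : lmodType K) (alpha : {linear V -> V})
    (g h : hmorphism (FHNAs alpha) A) :
  (forall v, g (finj V v) = h (finj V v)) -> g =1 h.
Proof.
move=> gh; apply: freeNAs_linear_ext => t x.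
by rewrite !free_hmorphism_teval; congr teval; apply/funext.
Qed.

End TreeEvaluation.

Section Unit.
Variables (K : fieldType) (L : homNonAs K).

Definition env_unit_lin : {linear L -> env L} :=
  hpi (env_twist_ideal L) \o finj L.

Lemma env_unit_twist x :
  @htwist K (hlie (env L)) (env_unit_lin x) = env_unit_lin (htwist x).
Proof.
rewrite /= hpi_twist; congr (qpi _ _).
by rewrite !(mklinE (@finj_linear _ _)) /= ftwist_leaf.
Qed.

(** The two sides differ by the class of a bracket generator of I^1, which is [env_ideal 0]. *)
Lemma env_unit_mul x y :
  env_unit_lin (hmul x y)
  = @hmul K (hlie (env L)) (env_unit_lin x) (env_unit_lin y).
Proof.
have unitE z : env_unit_lin z = qpi (tideal_submodule (env_twist_ideal L)) (fincl z).
  by [].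
rewrite hlie_mulE !unitE -!hpi_mul -linearB; apply/qpi_eq.
by exists 0%N => //; apply: sub_ideal_gen; right; exists x, y.
Qed.

Definition env_unit : hmorphism L (hlie (env L)) :=
  @HMorphism K L (hlie (env L)) env_unit_lin env_unit_twist env_unit_mul.

Lemma env_hmorphism_ext (A : homNonAs K) (g h : hmorphism (env L) A) :
  (forall x, g (env_unit x) = h (env_unit x)) -> g = h.
Proof.
move=> gh; apply: hquot_ext.
exact: (@free_hmorphism_ext _ _ _ _ (hcomp g (hpi _))
  (hcomp h (hpi _)) gh).
Qed.

Section Lift.
Variables (A : homNonAs K) (asA : hom_associative A).
Variable f : hmorphism L (hlie A).

(** [hlie A] has the module and twist of [A], so [f] extends to the free algebra; its compatibility
    with brackets enters in [env_lift0]. *)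
Let g : hmorphism (freeOn L) A :=
  @free_hlift K A L (f : {linear L -> A}) htwist (hmap_twist f).

Lemma env_lift0 x : env_twist_ideal L x -> g x = 0.
Proof.
(* As the kernel is an ideal, only the generating set of each I^n has to be checked. *)
have kerI : @two_sided_ideal K (freeOn L) (g @^-1` [set 0]).
  apply: ideal_preimage; split; last first.
    by move=> u v ->; rewrite linear0r linear0l.
  by split=> // a u v -> ->; rewrite scaler0 addr0.
move=> [n _]; elim: n x => [|n IH].
  apply: smallest_sub => // _ [[t _ <-]|[x [y ->]]].
    (* [g] carries the Hom-associator to that of [A], which vanishes on pure tensors by [asA]. *)
    change (g (hassociator _ t) = 0).
    rewrite hassociator_morph; move: (tmap _ _ _).
    apply: (@tpow_linear_ext _ _ _ _ (hassociator A) \0) => x.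
    by rewrite tliftE /hassoc_fun asA subrr.
  change (g (fincl (hmul x y)
    - (hmul (fincl x) (fincl y) - hmul (fincl y) (fincl x))) = 0).
  rewrite 2!linearB !hmap_mul /fincl !free_hlift_incl hmap_mul hlie_mulE.
  by rewrite subrr.
apply: smallest_sub => // z [|[x Ix <-]]; first exact: IH.
change (g (htwist x) = 0).
by rewrite -hmap_twist (IH x Ix) linear0.
Qed.

Definition env_lift : hmorphism (env L) A := hlift env_lift0.

Lemma env_lift_unit x : env_lift (env_unit x) = f x.
Proof.
transitivity (g (fincl x)); last exact: free_hlift_incl.
exact: (@hliftE _ _ _ _ g env_lift0 (fincl x)).
Qed.

End Lift.
End Unit.

(** This naturality of the unit yields naturality of the adjunction bijection in [L]. *)
Lemma env_map_unit (K : fieldType) (L L' : homNonAs K) (f : hmorphism L L') x :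
  env_map f (env_unit L x) = env_unit L' (f x).
Proof.
exact: etrans (env_mapE f _) (congr1 (hpi (env_twist_ideal L')) (free_map_incl f x)).
Qed.

Theorem theorem4p4 (K : fieldType) (charK : [pchar K] =i pred0) :
  left_adjoint (UHLie K) (HLie K).
Proof.
exists (fun L A (g : hmorphism (env (sval L)) (sval A)) =>
  hcomp (hlie_mor g) (env_unit (sval L))).
split=> [L A|L L' A f g|L A A' h g]; last first.
- exact: hmorphism_ext.
- by apply: hmorphism_ext => x; congr (g _); exact: (env_map_unit f x).
(* One composite is the identity by uniqueness of extensions along the unit, the other because
   [env_lift] extends [f]. *)
exists (fun f => env_lift (svalP A) f) => [g|f].
  by apply: env_hmorphism_ext => x; rewrite env_lift_unit.
by apply: hmorphism_ext => x; exact: (env_lift_unit (svalP A) f x).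
Qed.
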